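(* Let $\mathcal P_t=e^{t\mathcal L}$ be a primitive quantum Markov semigroup satisfying the $\sigma$-KMS detailed balance condition for its full-rank invariant state $\sigma$, and let $p>1$. (a) If the sandwiched Rényi entropic inequality $$2\hat\alpha_p\,D_p(\rho\|\sigma)\le\frac{4\,\mathcal E_{p,\mathcal L}(\Gamma_\sigma^{-1}(\rho))}{p\,\|\Gamma_\sigma^{-1}(\rho)\|_{p,\sigma}^p}\qquad\text{for all }\rho\in\mathcal D(\mathcal H)$$ holds for some $\hat\alpha_p>0$, then the $p$-Beckner inequality $$\alpha_p\,\mathcal F_{p,\sigma}(\rho)\le p^{-2}\,\mathcal E_{p,\mathcal L}(\Gamma_\sigma^{-1}(\rho))\qquad\text{for all }\rho\in\mathcal D_+(\mathcal H)$$ holds with a constant $\alpha_p\ge\hat\alpha_p/2$. (b) Conversely, if the $p$-Beckner inequality in (a) holds with constant $\alpha_p>0$, then for every $a>0$, with $c_a=(1-e^{-a})/a$, and every $\rho\in\mathcal D(\mathcal H)$, $$\frac{4\,\mathcal E_{p,\mathcal L}(\Gamma_\sigma^{-1}(\rho))}{p\,\|\Gamma_\sigma^{-1}(\rho)\|_{p,\sigma}^p}\ \ge\ \begin{cases}4c_a\,\alpha_p\,D_p(\rho\|\sigma)&\text{if }D_p(\rho\|\sigma)\le\frac{a}{p-1},\\[2pt]\frac{4\alpha_p}{p-1}(1-e^{-a})&\text{if }D_p(\rho\|\sigma)\ge\frac{a}{p-1}.\end{cases}$$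
   Context: $\mathcal H$ is a finite-dimensional Hilbert space, $\mathcal B(\mathcal H)$ the operators on it, $\mathcal D(\mathcal H)$ the density operators and $\mathcal D_+(\mathcal H)$ the full-rank ones. A quantum Markov semigroup (QMS) is a $C_0$-semigroup $(\mathcal P_t)_{t\ge0}$ of completely positive unital maps on $\mathcal B(\mathcal H)$, with generator $\mathcal L$; $\dagger$ is the adjoint for the Hilbert–Schmidt inner product. It is primitive if it has a unique invariant state $\sigma$ ($\mathcal P_t^\dagger(\sigma)=\sigma$ for all $t$) and $\sigma$ has full rank. The $\sigma$-KMS detailed balance condition means that $\mathcal L$ is self-adjoint for $\langle X,Y\rangle_{\sigma,1/2}=\mathrm{Tr}(\sigma^{1/2}X^*\sigma^{1/2}Y)$. Let $\Gamma_\sigma^{s}(X)=\sigma^{s/2}X\sigma^{s/2}$ for $s\in\mathbb R$, $\|X\|_{p,\sigma}=\mathrm{Tr}\big(|\Gamma_\sigma^{1/p}(X)|^p\big)^{1/p}$, and $\hat p=p/(p-1)$. For $p>1$ and $X\ge0$, $$\mathcal E_{p,\mathcal L}(X)=-\frac{\hat p\,p}{4}\Big\langle \Gamma_\sigma^{-1/\hat p}\big((\Gamma_\sigma^{1/p}(X))^{p-1}\big),\mathcal L(X)\Big\rangle_{\sigma,1/2}.$$ The sandwiched Rényi relative entropy is $D_p(\rho\|\sigma)=\hat p\log\|\Gamma_\sigma^{-1}(\rho)\|_{p,\sigma}$ and the quantum $p$-divergence is $\mathcal F_{p,\sigma}(\rho)=\frac{1}{p(p-1)}\big(\|\Gamma_\sigma^{-1}(\rho)\|_{p,\sigma}^p-1\big)$.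 *)

(* Defs.v *)
From HB Require Import structures.
From mathcomp Require Import all_boot all_order all_algebra.
From mathcomp Require Import all_classical all_reals all_analysis.
From mathcomp Require Export complex.

Set Implicit Arguments.
Unset Strict Implicit.
Unset Printing Implicit Defensive.

Import Order.TTheory GRing.Theory Num.Theory.
Import numFieldNormedType.Exports.

Local Open Scope classical_set_scope.
Local Open Scope ring_scope.
Local Open Scope complex_scope.
Local Open Scope sesquilinear_scope.

(* The Hilbert space is C^n: operators are complex n x n matrices, and [^t*] is
   the adjoint. *)
Notation opmx R n := 'M[R[i]]_n.

Definition psdmx (R : realType) (n : nat) (A : opmx R n) : Prop :=
  forall v : 'cV[R[i]]_n, 0 <= (v^t* *m A *m v) 0 0.

Definition density (R : realType) (n : nat) (rho : opmx R n) : Prop :=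
  psdmx rho /\ \tr rho = 1.

Definition faithful_density (R : realType) (n : nat) (rho : opmx R n) : Prop :=
  density rho /\ \rank rho = n.

(* The ampliation [id_k (x) Phi] acts on k x k block matrices blockwise. *)
Definition completely_positive (R : realType) (n : nat)
    (Phi : opmx R n -> opmx R n) : Prop :=
  forall (k : nat) (X : 'I_k -> 'I_k -> opmx R n),
    psdmx (\mxblock_(i < k, j < k) X i j) ->
    psdmx (\mxblock_(i < k, j < k) Phi (X i j)).

(* [R[i]] inherits its norm topology only when seen as a [numFieldType]. *)
Notation topmx R n := 'M[(R[i] : numFieldType)]_n.

(* Only the values [P t] at times [0 <= t] are meaningful. *)
Record quantum_markov_semigroup (R : realType) (n : nat)
    (P : R -> {linear opmx R n -> opmx R n}) : Prop := QuantumMarkovSemigroup {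
  qms_id : forall X, P 0 X = X;
  qms_comp : forall s t X, 0 <= s -> 0 <= t -> P (s + t) X = P s (P t X);
  qms_cts : forall X, (P t X : topmx R n) @[t --> 0^'+] --> (X : topmx R n);
  qms_cp : forall t, 0 <= t -> completely_positive (P t);
  qms_unital : forall t, 0 <= t -> P t 1%:M = 1%:M }.

Definition generator (R : realType) (n : nat)
    (P : R -> {linear opmx R n -> opmx R n})
    (L : {linear opmx R n -> opmx R n}) : Prop :=
  forall X,
    ((t^-1)%:C *: (P t X - X) : topmx R n) @[t --> 0^'+]
      --> (L X : topmx R n).

(* Hilbert-Schmidt adjoint, computed on the matrix units; see [hs_adjP]. *)
Definition hs_adj (R : realType) (n : nat) (Phi : opmx R n -> opmx R n)
    (A : opmx R n) : opmx R n :=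
  \matrix_(i, j) (\tr (A^t* *m Phi (delta_mx i j)))^*.

Lemma hs_adjP (R : realType) (n : nat) (Phi : {linear opmx R n -> opmx R n})
    (A B : opmx R n) :
  \tr ((hs_adj Phi A)^t* *m B) = \tr (A^t* *m Phi B).
Proof.
rewrite {2}(matrix_sum_delta B) linear_sum mulmx_sumr linear_sum /=.
under [RHS]eq_bigr do rewrite linear_sum mulmx_sumr linear_sum /=.
rewrite exchange_big /=; apply: eq_bigr => j _.
rewrite mxE; apply: eq_bigr => i _.
by rewrite linearZ /= -scalemxAr linearZ /= !mxE conjCK mulrC.
Qed.

Definition invariant_state (R : realType) (n : nat)
    (P : R -> {linear opmx R n -> opmx R n}) (rho : opmx R n) : Prop :=
  density rho /\ forall t, 0 <= t -> hs_adj (P t) rho = rho.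

Definition primitive_with (R : realType) (n : nat)
    (P : R -> {linear opmx R n -> opmx R n}) (sigma : opmx R n) : Prop :=
  [/\ invariant_state P sigma, \rank sigma = n
    & forall rho, invariant_state P rho -> rho = sigma].

(* Functional calculus for Hermitian matrices: [spectral_diag A] lists the
   (then real) eigenvalues and [spectralmx A] is a diagonalizing unitary.
   No meaning is attached to it when [A] is not Hermitian. *)
Definition mxfun (R : realType) (n : nat) (f : R -> R) (A : opmx R n) :
    opmx R n :=
  invmx (spectralmx A)
    *m diag_mx (map_mx (fun z : R[i] => (f (complex.Re z))%:C) (spectral_diag A))
    *m spectralmx A.

Definition mxpow (R : realType) (n : nat) (A : opmx R n) (s : R) : opmx R n :=
  mxfun (fun x => x `^ s) A.

Definition mxabs (R : realType) (n : nat) (A : opmx R n) : opmx R n :=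
  mxfun Num.sqrt (A^t* *m A).

Definition kms_inner (R : realType) (n : nat) (sigma X Y : opmx R n) : R[i] :=
  \tr (mxpow sigma (1 / 2) *m X^t* *m mxpow sigma (1 / 2) *m Y).

Definition kms_detailed_balance (R : realType) (n : nat) (sigma : opmx R n)
    (L : opmx R n -> opmx R n) : Prop :=
  forall X Y, kms_inner sigma (L X) Y = kms_inner sigma X (L Y).

Definition Gamma (R : realType) (n : nat) (sigma : opmx R n) (s : R)
    (X : opmx R n) : opmx R n :=
  mxpow sigma (s / 2) *m X *m mxpow sigma (s / 2).

(* The trace is that of a positive semidefinite matrix, so [Re] only changes
   its type. *)
Definition pnorm (R : realType) (n : nat) (p : R) (sigma X : opmx R n) : R :=
  (complex.Re (\tr (mxpow (mxabs (Gamma sigma p^-1 X)) p))) `^ p^-1.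

Definition hconj (R : realType) (p : R) : R := p / (p - 1).

(* Meant for [psdmx X].  For [L] the generator of a quantum Markov semigroup,
   [L X] is then Hermitian, the pairing is real and [Re] only changes its
   type. *)
Definition energy (R : realType) (n : nat) (p : R) (sigma : opmx R n)
    (L : opmx R n -> opmx R n) (X : opmx R n) : R :=
  - (hconj p * p / 4) *
  complex.Re (kms_inner sigma
    (Gamma sigma (- (hconj p)^-1) (mxpow (Gamma sigma p^-1 X) (p - 1))) (L X)).

Definition sandwiched_renyi (R : realType) (n : nat) (p : R)
    (rho sigma : opmx R n) : R :=
  hconj p * ln (pnorm p sigma (Gamma sigma (-1) rho)).

Definition pdivergence (R : realType) (n : nat) (p : R)
    (sigma rho : opmx R n) : R :=
  (pnorm p sigma (Gamma sigma (-1) rho) `^ p - 1) / (p * (p - 1)).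

(* Right-hand side of the sandwiched Renyi entropic inequality. *)
Definition renyi_production (R : realType) (n : nat) (p : R)
    (sigma : opmx R n) (L : opmx R n -> opmx R n) (rho : opmx R n) : R :=
  4 * energy p sigma L (Gamma sigma (-1) rho) /
  (p * pnorm p sigma (Gamma sigma (-1) rho) `^ p).

Definition renyi_inequality (R : realType) (n : nat) (p : R)
    (sigma : opmx R n) (L : opmx R n -> opmx R n) (alpha : R) : Prop :=
  forall rho, density rho ->
    2 * alpha * sandwiched_renyi p rho sigma <= renyi_production p sigma L rho.

Definition beckner_inequality (R : realType) (n : nat) (p : R)
    (sigma : opmx R n) (L : opmx R n -> opmx R n) (alpha : R) : Prop :=
  forall rho, faithful_density rho ->
    alpha * pdivergence p sigma rho <=
    p ^- 2 * energy p sigma L (Gamma sigma (-1) rho).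

(* Main.v *)
Require Import Defs.
From HB Require Import structures.
From mathcomp Require Import all_boot all_order all_algebra.
From mathcomp Require Import all_classical all_reals all_analysis.
From mathcomp Require Import ring lra.

(** Write [A = Gamma_sigma^(1/p - 1) rho], so that
    [rho = Gamma_sigma^(1 - 1/p) A], and let [d] be the eigenvalues of [A]. Then
    [x = \sum_i d_i^p] is the [p]-th power of the weighted norm of
    [Gamma_sigma^-1 rho], the Renyi entropy is [D = ln x / (p - 1)], the
    divergence is [F = (x - 1) / (p (p - 1))], and both inequalities compare the
    same energy [E] with a function of the single number [x]
    ([pnorm_powR], [sandwiched_renyi_spectral], [renyi_production_spectral]).
    Part (a) is then [x - 1 <= x ln x]. Part (b) is
    [4 E / (p x) >= 4 alpha / (p - 1) * (1 - 1 / x)] with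
    [1 / x = exp (- (p - 1) D)], combined with the concavity of [1 - exp (- y)]
    on [[0, a]] in the first case and its monotonicity in the second.

    Two facts about [x] and [E] remain. First, (a) needs [x > 0] and the
    concavity bound needs [D >= 0]; both follow from [x >= 1]
    ([density_power_sum_ge1]). With [q] conjugate to [p], this is Young's
    inequality for the trace ([trace_young]) applied to
    [1 = tr rho = tr (A sigma^(1/q))], as [tr ((sigma^(1/q))^q) = 1].

    Second, (b) is about all densities, whereas the Beckner inequality is
    assumed for faithful ones only, so one has to pass to the limit
    ([beckner_density]). Approximating [A] by normalized [A + t 1] instead of
    moving [rho] towards [sigma] keeps the eigenvectors fixed
    ([udiag_density_mix]). Along this path the functional calculus acts on the
    eigenvalues alone: [x] and [E] become finite sums of powers of the [d_i]
    with constant coefficients ([energy_quadratic]), and their convergence is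
    that of real powers ([cvg_powR]). *)

Set Implicit Arguments.
Unset Strict Implicit.
Unset Printing Implicit Defensive.

Import Order.TTheory GRing.Theory Num.Theory.
Import numFieldNormedType.Exports.
Local Open Scope ring_scope.

Local Open Scope complex_scope.
Local Open Scope sesquilinear_scope.
Local Open Scope classical_set_scope.

(** * Hermitian matrices in an eigenbasis *)

Section Matrices.
Variables (R : realType) (n : nat).
Implicit Types (A B V W : opmx R n) (d e : 'rV[R]_n).

Lemma adjM (a b c : nat) (A : 'M[R[i]]_(a, b)) (B : 'M[R[i]]_(b, c)) :
  (A *m B)^t* = B^t* *m A^t*.
Proof. by rewrite trmx_mul map_mxM. Qed.

Lemma unitary_adjK V : V \is unitarymx -> V^t* *m V = 1%:M.
Proof. by move=> hV; rewrite -invmx_unitary// mulVmx// unitarymx_unit. Qed.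

(** Row [i] of the unitary [V] is the adjoint of an eigenvector for [d i]; this
    is the convention of [spectralmx] and [spectral_diag]. *)
Definition udiag V d : opmx R n :=
  V^t* *m diag_mx (map_mx (real_complex R) d) *m V.

Lemma adj_udiag V d : (udiag V d)^t* = udiag V d.
Proof.
rewrite /udiag (adjM _ V) (adjM (V^t*)) trmxCK mulmxA; do 2 f_equal.
rewrite tr_diag_mx map_diag_mx; f_equal.
by apply/matrixP => i j; rewrite !mxE; apply: conjc_real.
Qed.

Lemma normalmx_diag A : A^t* *m A = A *m A^t* ->
  exists S (e : 'rV[R[i]]_n),
    [/\ S \is unitarymx, A = S^t* *m diag_mx e *m S,
       spectralmx A = S & spectral_diag A = e].
Proof.
move=> hA; have hS : spectralmx A \is unitarymx by apply: spectral_unitarymx.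
have /orthomx_spectralP := introT normalmxP (esym hA).
by rewrite (invmx_unitary hS) => hAe; exists (spectralmx A), (spectral_diag A).
Qed.

(** Functional calculus does not depend on the eigenbasis: the change of basis
    [T] between two diagonalizations has [T i j = 0] unless the eigenvalues of
    index [i] and [j] agree, hence it still intertwines after applying [f]. *)
Lemma mxfun_udiag (f : R -> R) V d : V \is unitarymx ->
  mxfun f (udiag V d) = udiag V (map_mx f d).
Proof.
move=> hV; rewrite /mxfun; set A := udiag V d.
have [|S [e [hS hA -> ->]]] := @normalmx_diag A; first by rewrite adj_udiag.
rewrite (invmx_unitary hS).
have /unitarymxP SS := hS.
have /unitarymxP VV := hV.
have VV' := unitary_adjK hV; have SS' := unitary_adjK hS.
have [T TE] : exists T, T = S *m V^t* by exists (S *m V^t*).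
have hT : T *m diag_mx (map_mx (real_complex R) d) = diag_mx e *m T.
  (* Expand [S A V^*] with one diagonalization of [A] on each side. *)
  have : S *m A *m V^t* = S *m A *m V^t* by [].
  rewrite {1}/A /udiag hA TE !mulmxA SS mul1mx => <-.
  by rewrite -!mulmxA VV mulmx1.
have {}hT : T *m diag_mx (map_mx (real_complex R) (map_mx f d)) =
    diag_mx (map_mx (fun z : R[i] => (f (complex.Re z))%:C) e) *m T.
  apply/matrixP => i j; move/matrixP/(_ i j): hT.
  rewrite !mul_mx_diag !mul_diag_mx !mxE.
  have [->|Tij0] := eqVneq (T i j) 0; first by rewrite !mul0r !mulr0.
  rewrite (mulrC (T i j)) => h; have <- := mulIf Tij0 h.
  by rewrite /= mulrC.
set F := diag_mx (map_mx (fun z : R[i] => _) e) in hT *.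
have ST : S = T *m V by rewrite TE -mulmxA VV' mulmx1.
by rewrite [X in _ *m X]ST mulmxA -(mulmxA _ F) -hT TE !mulmxA SS' mul1mx.
Qed.

Lemma quad_eigen V (c : 'rV[R[i]]_n) i : V \is unitarymx ->
  let v := V^t* *m delta_mx i (0 : 'I_1) in
  (v^t* *m (V^t* *m diag_mx c *m V) *m v) 0 0 = c 0 i.
Proof.
move=> /unitarymxP hV v; rewrite /v adjM trmxCK !mulmxA.
rewrite -(mulmxA _ V) hV mulmx1 -(mulmxA _ V) hV mulmx1.
rewrite mxE (bigD1 i)//= big1 ?addr0; last first.
  by move=> j ji; rewrite [X in _ * X]mxE (negbTE ji) mulr0.
rewrite [X in _ * X]mxE !eqxx mulr1 mul_mx_diag mxE !mxE !eqxx /=.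
by rewrite rmorph1 mul1r.
Qed.

(** [A - A^*] is skew-Hermitian, hence normal, and its eigenvalues are values of
    its quadratic form, which vanishes because that of [A] is real. *)
Lemma psdmx_herm A : psdmx A -> A^t* = A.
Proof.
move=> hA; apply/eqP; rewrite eq_sym -subr_eq0; apply/eqP.
set B := A - A^t*.
have BN : B^t* = - B by rewrite /B linearB/= map_mxB trmxCK opprB.
have [|S [e [hS hB _ _]]] := @normalmx_diag B.
  by rewrite BN mulmxN mulNmx.
suff e0 : e = 0 by rewrite hB e0 linear0 mulmx0 mul0mx.
apply/rowP => i; rewrite -(quad_eigen e i hS) -hB [RHS]mxE /B.
move: (_ *m delta_mx _ _) => v; have h := hA v.
have -> : v^t* *m (A - A^t*) *m v = v^t* *m A *m v - (v^t* *m A *m v)^t*.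
  by rewrite adjM (adjM _ A) trmxCK mulmxBr mulmxBl mulmxA.
move: (v^t* *m A *m v) h => w h; rewrite !mxE.
by apply/eqP; rewrite subr_eq0 eq_sym; apply/eqP; rewrite (CrealP _) ?ger0_real.
Qed.

Lemma psdmx_udiag A : psdmx A ->
  exists V d, [/\ V \is unitarymx, forall i, 0 <= d 0 i & A = udiag V d].
Proof.
move=> hA.
have [|S [e [hS hAe _ _]]] := @normalmx_diag A; first by rewrite psdmx_herm.
have e0 i : 0 <= e 0 i by rewrite -(quad_eigen e i hS) -hAe.
have eE : e = map_mx (real_complex R) (map_mx (@complex.Re R) e).
  by apply/rowP => i; rewrite !mxE RRe_real// ger0_real.
exists S, (map_mx (@complex.Re R) e); split; [exact: hS| |by rewrite /udiag -eE].
by move=> i; rewrite mxE; have := e0 i; rewrite lecE => /andP[].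
Qed.

Lemma udiag_psd V d : (forall i, 0 <= d 0 i) -> psdmx (udiag V d).
Proof.
move=> d0 v; rewrite /udiag !mulmxA -adjM -mulmxA.
rewrite mxE; apply: sumr_ge0 => i _; rewrite mul_mx_diag !mxE.
rewrite -mulrA mulrCA -normCKC mulr_ge0 ?exprn_ge0// ?lecR//.
Qed.

Lemma psdmx_congr B A : psdmx A -> psdmx (B^t* *m A *m B).
Proof. by move=> hA v; rewrite !mulmxA -adjM -(mulmxA _ B); apply: hA. Qed.

Lemma udiagM V d e : V \is unitarymx ->
  udiag V d *m udiag V e = udiag V (\row_i (d 0 i * e 0 i)).
Proof.
move=> /unitarymxP hV; rewrite /udiag.
rewrite -!mulmxA (mulmxA V) hV mul1mx (mulmxA (diag_mx _)) mulmx_diag.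
do 3 f_equal.
by apply/rowP => i; rewrite !mxE rmorphM.
Qed.

Lemma udiag1 V : V \is unitarymx -> udiag V (const_mx 1) = 1%:M.
Proof.
by move=> hV; rewrite /udiag map_const_mx diag_const_mx mulmx1 unitary_adjK.
Qed.

Lemma tr_udiag V d : V \is unitarymx -> \tr (udiag V d) = (\sum_i d 0 i)%:C.
Proof.
move=> /unitarymxP hV; rewrite /udiag mxtrace_mulC mulmxA hV mul1mx.
by rewrite mxtrace_diag rmorph_sum; apply: eq_bigr => i _; rewrite mxE.
Qed.

Lemma udiag_sum V d :
  udiag V d = \sum_i (d 0 i)%:C *: udiag V (delta_mx 0 i).
Proof.
have -> : udiag V d = V^t* *m
    (\sum_i (d 0 i)%:C *: diag_mx (map_mx (real_complex R) (delta_mx 0 i))) *m V.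
  congr (_ *m _ *m _); apply/matrixP => i j; rewrite summxE (bigD1 i)//= big1.
    by rewrite addr0 !mxE !eqxx mulrnAr mulr1.
  by move=> k ki; rewrite !mxE eq_sym (negbTE ki) /= mul0rn mulr0.
rewrite mulmx_sumr mulmx_suml; apply: eq_bigr => i _.
by rewrite -scalemxAr -scalemxAl.
Qed.

Lemma udiag_affine V d (k t : R) : V \is unitarymx ->
  udiag V (\row_i (k * (d 0 i + t))) = k%:C *: (udiag V d + t%:C *: 1%:M).
Proof.
move=> hV; rewrite -(udiag1 hV) /udiag.
move: (V^t*) => V'; rewrite scalemxAl scalemxAr -mulmxDl -mulmxDr.
rewrite scalemxAl scalemxAr; f_equal; f_equal.
apply/matrixP => i j; rewrite !mxE.
by case: (i == j); rewrite ?mulr1n ?mulr0n ?mulr0 ?addr0 ?mulr0 // mulr1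
  !(rmorphM, rmorphD).
Qed.

Lemma udiag_unit V d : V \is unitarymx ->
  (udiag V d \in unitmx) = [forall i, d 0 i != 0].
Proof.
move=> /unitarymx_unit hV; rewrite /udiag !unitmx_mul hV andbT.
rewrite map_unitmx unitmx_tr hV /= unitmxE det_diag unitfE.
apply/idP/forallP => [h i|h].
  by apply: contraNneq h => h; apply/prodf_eq0; exists i; rewrite // mxE h.
by apply/prodf_neq0 => i _; rewrite mxE fmorph_eq0.
Qed.

End Matrices.

(** * Real powers of a faithful state and the maps Gamma *)

Lemma mxtrace_regroup (C : comPzSemiRingType) (n : nat)
    (V' D V W' E W : 'M[C]_n) :
  \tr ((V' *m D *m V) *m (W' *m E *m W)) =
  \tr (D *m (V *m W') *m E *m (W *m V')).
Proof. by rewrite -!mulmxA mxtrace_mulC !mulmxA. Qed.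

(** Here [S] stands for [r |-> sigma^r]. *)
Section Sandwich.
Variables (R : numFieldType) (C : comPzSemiRingType) (n : nat) (S : R -> 'M[C]_n).
Hypothesis SD : forall r t, S r *m S t = S (r + t).

Lemma sandwichD r t X :
  S (r / 2) *m (S (t / 2) *m X *m S (t / 2)) *m S (r / 2) =
  S ((r + t) / 2) *m X *m S ((r + t) / 2).
Proof.
rewrite !mulmxA SD -(mulmxA _ (S (t / 2))) SD.
by rewrite (addrC (t / 2)) -mulrDl.
Qed.

Lemma tr_sandwich r X :
  \tr (S (r / 2) *m X *m S (r / 2)) = \tr (X *m S r).
Proof. by rewrite mxtrace_mulC mulmxA SD -splitr mxtrace_mulC. Qed.

End Sandwich.

Section TraceYoung.
Variables (R : realType) (n : nat).
Implicit Types (V W : opmx R n) (d e : 'rV[R]_n).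

(** [Z i j] is the squared modulus of the overlap of the [i]-th vector of one
    eigenbasis with the [j]-th vector of the other, so [Z] is doubly
    stochastic. *)
Lemma tr_mul_udiag V W d e : V \is unitarymx -> W \is unitarymx ->
  exists Z : 'I_n -> 'I_n -> R,
    [/\ forall i j, 0 <= Z i j,
        forall i, \sum_j Z i j = 1, forall j, \sum_i Z i j = 1
      & \tr (udiag V d *m udiag W e) =
          (\sum_i \sum_j Z i j * (d 0 i * e 0 j))%:C].
Proof.
move=> hV hW; have [T TE] : exists T, T = V *m W^t* by exists (V *m W^t*).
have hT : T \is unitarymx
  by rewrite TE; apply: mul_unitarymx hV _; rewrite trmxC_unitary.
have /matrixP TT := elimT unitarymxP hT.
have /matrixP TT' := unitary_adjK hT.
pose Z i j := complex.Re (T i j * (T i j)^*).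
have ZE i j : (Z i j)%:C = T i j * (T i j)^*.
  by rewrite RRe_real// ger0_real// mul_conjC_ge0.
exists Z; split.
- by move=> i j; rewrite -lecR ZE mul_conjC_ge0.
- move=> i; apply: (@complexI R); rewrite rmorph_sum rmorph1.
  have := TT i i; rewrite mxE [RHS]mxE eqxx mulr1n => <-.
  by apply: eq_bigr => j _; rewrite /= ZE !mxE.
- move=> j; apply: (@complexI R); rewrite rmorph_sum rmorph1.
  have := TT' j j; rewrite mxE [RHS]mxE eqxx mulr1n => <-.
  by apply: eq_bigr => i _; rewrite /= ZE !mxE mulrC.
have -> : \tr (udiag V d *m udiag W e) =
    \tr (diag_mx (map_mx (real_complex R) d) *m T *m
         diag_mx (map_mx (real_complex R) e) *m T^t*).
  have TE' : T^t* = W *m V^t* by rewrite TE (adjM V) trmxCK.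
  by rewrite TE' TE; apply: mxtrace_regroup.
rewrite rmorph_sum /mxtrace; apply: eq_bigr => i _.
rewrite mxE rmorph_sum; apply: eq_bigr => j _.
rewrite mul_mx_diag mxE mul_diag_mx !mxE !rmorphM /= ZE.
by ring.
Qed.

(** The scalar Young inequality for each pair of eigenvalues, averaged with the
    doubly stochastic overlaps. *)
Lemma trace_young V W d e (p q : R) :
  V \is unitarymx -> W \is unitarymx ->
  (forall i, 0 <= d 0 i) -> (forall i, 0 <= e 0 i) ->
  0 < p -> 0 < q -> p^-1 + q^-1 = 1 ->
  complex.Re (\tr (udiag V d *m udiag W e)) <=
    (\sum_i d 0 i `^ p) / p + (\sum_j e 0 j `^ q) / q.
Proof.
move=> hV hW d0 e0 p0 q0 pq.
have [Z [Z0 Zr Zc ->]] := tr_mul_udiag d e hV hW.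
have -> : (\sum_i d 0 i `^ p) / p + (\sum_j e 0 j `^ q) / q =
    \sum_i \sum_j Z i j * (d 0 i `^ p / p + e 0 j `^ q / q).
  under [RHS]eq_bigr => i _ do under eq_bigr => j _ do rewrite mulrDr.
  under [RHS]eq_bigr => i _ do rewrite big_split/= -mulr_suml Zr mul1r.
  rewrite big_split/= exchange_big/=.
  under [X in _ = _ + X]eq_bigr => i _ do rewrite -mulr_suml Zc mul1r.
  by rewrite !mulr_suml.
apply: ler_sum => i _; apply: ler_sum => j _; apply: ler_wpM2l => //.
exact: conjugate_powR.
Qed.

Lemma mxpow_udiag V d r : V \is unitarymx ->
  mxpow (udiag V d) r = udiag V (map_mx (fun x => x `^ r) d).
Proof. exact: mxfun_udiag. Qed.

End TraceYoung.

Opaque udiag mxpow.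

Lemma adj_real_sum (R : realType) n (I : finType) (a : I -> R) (X : I -> opmx R n) :
  (\sum_i (a i)%:C *: X i)^t* = \sum_i (a i)%:C *: (X i)^t*.
Proof.
rewrite raddf_sum (big_morph _ (@map_mxD _ _ _ _ _) (@map_mx0 _ _ _ _ _)).
apply: eq_bigr => i _; apply/matrixP => j k.
rewrite !mxE /= rmorphM; congr (_ * _); apply: conjc_real.
Qed.

Lemma tr_mul_sum (C : comPzRingType) n (I J : finType) (S : 'M[C]_n)
    (a : I -> C) (b : J -> C) (X : I -> 'M[C]_n) (Y : J -> 'M[C]_n) :
  \tr (S *m (\sum_i a i *: X i) *m S *m (\sum_j b j *: Y j)) =
  \sum_i \sum_j a i * b j * \tr (S *m X i *m S *m Y j).
Proof.
rewrite [S *m _]mulmx_sumr !mulmx_suml raddf_sum; apply: eq_bigr => i _.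
rewrite mulmx_sumr raddf_sum; apply: eq_bigr => j _ /=.
by rewrite -!scalemxAr -!scalemxAl !mxtraceZ mulrA (mulrC (b j)).
Qed.

Lemma kms_inner_sum (R : realType) n (sigma : opmx R n) (I J : finType)
    (a : I -> R) (b : J -> R) (X : I -> opmx R n) (Y : J -> opmx R n) :
  kms_inner sigma (\sum_i (a i)%:C *: X i) (\sum_j (b j)%:C *: Y j) =
  \sum_i \sum_j (a i * b j)%:C * kms_inner sigma (X i) (Y j).
Proof.
rewrite /kms_inner adj_real_sum.
move: (mxpow _ _) => S; rewrite tr_mul_sum.
by apply: eq_bigr => i _; apply: eq_bigr => j _; rewrite rmorphM.
Qed.

Lemma ReZ (R : realType) (r : R) (z : R[i]) :
  complex.Re (r%:C * z) = r * complex.Re z.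
Proof. by case: z => x y /=; rewrite mul0r subr0. Qed.

Section FaithfulPowers.
Variables (R : realType) (n : nat).
Implicit Types (sigma rho X A V : opmx R n) (d : 'rV[R]_n).

Lemma faithful_udiag sigma : faithful_density sigma ->
  exists U (s : 'rV[R]_n), [/\ U \is unitarymx, forall i, 0 < s 0 i,
    \sum_i s 0 i = 1 & sigma = udiag U s].
Proof.
move=> [[/psdmx_udiag [U [s [hU s0 ->]]] tr1] rk].
exists U, s; split => //.
  move=> i; rewrite lt_def s0 andbT.
  have : udiag U s \in unitmx by rewrite -row_free_unit /row_free rk.
  by rewrite udiag_unit// => /forallP/(_ i).
by apply: (@complexI R); rewrite -(tr_udiag _ hU).
Qed.

Variable sigma : opmx R n.
Hypothesis hsigma : faithful_density sigma.

Lemma mxpow_adj r : (mxpow sigma r)^t* = mxpow sigma r.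
Proof.
have [U [s [hU _ _ ->]]] := faithful_udiag hsigma.
by rewrite (mxpow_udiag _ _ hU) adj_udiag.
Qed.

Lemma mxpowD r t : mxpow sigma r *m mxpow sigma t = mxpow sigma (r + t).
Proof.
have [U [s [hU s0 _ ->]]] := faithful_udiag hsigma.
rewrite !(mxpow_udiag _ _ hU) (udiagM _ _ hU); apply: (congr1 (udiag U)).
by apply/rowP => i; rewrite !mxE powRD// (gt_eqF (s0 i)) implybT.
Qed.

Lemma mxpow0 : mxpow sigma 0 = 1%:M.
Proof.
have [U [s [hU s0 _ ->]]] := faithful_udiag hsigma.
rewrite (mxpow_udiag _ _ hU) -(udiag1 hU); apply: (congr1 (udiag U)).
by apply/rowP => i; rewrite !mxE powRr0.
Qed.

Lemma mxpow_unit r : mxpow sigma r \in unitmx.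
Proof.
have h : mxpow sigma r *m mxpow sigma (- r) = 1%:M.
  by rewrite mxpowD subrr mxpow0.
exact: (mulmx1_unit h).1.
Qed.

Lemma GammaD r t X : Gamma sigma r (Gamma sigma t X) = Gamma sigma (r + t) X.
Proof.
exact: (sandwichD mxpowD).
Qed.

Lemma Gamma0 X : Gamma sigma 0 X = X.
Proof. by rewrite /Gamma mul0r mxpow0 mulmx1 mul1mx. Qed.

Lemma Gamma_psd r X : psdmx X -> psdmx (Gamma sigma r X).
Proof.
move=> /(psdmx_congr (mxpow sigma (r / 2))); by rewrite mxpow_adj.
Qed.

Lemma Gamma_unit r X : X \in unitmx -> Gamma sigma r X \in unitmx.
Proof.
have := mxpow_unit (r / 2); rewrite /Gamma; move: (mxpow _ _) => S hS hX.
by rewrite !unitmx_mul hS hX.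
Qed.

Lemma Gamma_sum I (c : I -> R) (X : I -> opmx R n) r (s : seq I) :
  Gamma sigma r (\sum_(i <- s) (c i)%:C *: X i) =
  \sum_(i <- s) (c i)%:C *: Gamma sigma r (X i).
Proof.
rewrite /Gamma mulmx_sumr mulmx_suml; apply: eq_bigr => i _.
by rewrite -scalemxAr -scalemxAl.
Qed.

Lemma tr_Gamma r X : \tr (Gamma sigma r X) = \tr (X *m mxpow sigma r).
Proof.
exact: (tr_sandwich mxpowD).
Qed.

Lemma pnorm_powR (p : R) V d : V \is unitarymx -> (forall i, 0 <= d 0 i) ->
  0 < p ->
  pnorm p sigma (Gamma sigma (- p^-1) (udiag V d)) `^ p = \sum_i d 0 i `^ p.
Proof.
move=> hV d0 p0; rewrite /pnorm GammaD subrr Gamma0.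
have -> : mxabs (udiag V d) = udiag V d.
  rewrite /mxabs adj_udiag (udiagM _ _ hV) (mxfun_udiag _ _ hV).
  apply: (congr1 (udiag V)).
  by apply/rowP => i; rewrite !mxE -expr2 sqrtr_sqr ger0_norm.
rewrite (mxpow_udiag _ _ hV) (tr_udiag _ hV) /= -powRrM mulVf ?gt_eqF// powRr1.
  by apply: eq_bigr => i _; rewrite mxE.
by apply: sumr_ge0 => i _; rewrite mxE powR_ge0.
Qed.

(** [udiag V] and [Gamma] are linear, so the energy is bilinear in the spectra of
    [A^(p-1)] and [A]. The coefficients [K] depend on the eigenbasis [V] but not
    on [d], which makes continuity in [d] elementary. *)
Lemma energy_quadratic (p : R) (L : {linear opmx R n -> opmx R n}) V :
  V \is unitarymx ->
  exists K : 'I_n -> 'I_n -> R, forall d, (forall i, 0 <= d 0 i) ->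
    energy p sigma L (Gamma sigma (- p^-1) (udiag V d)) =
      \sum_i \sum_j K i j * (d 0 i `^ (p - 1) * d 0 j).
Proof.
move=> hV; pose E i := udiag V (delta_mx 0 i).
pose K i j := - (hconj p * p / 4) * complex.Re
  (kms_inner sigma (Gamma sigma (- (hconj p)^-1) (E i))
                   (L (Gamma sigma (- p^-1) (E j)))).
exists K => d d0.
have fd i : map_mx (fun x => x `^ (p - 1)) d 0 i = d 0 i `^ (p - 1) by rewrite mxE.
rewrite /energy GammaD subrr Gamma0.
rewrite (mxpow_udiag _ _ hV) (udiag_sum V d) (udiag_sum V (map_mx _ _)).
rewrite !Gamma_sum (linear_sum L).
under [X in kms_inner _ _ X]eq_bigr => j _ do rewrite (linearZ_LR L).
rewrite kms_inner_sum raddf_sum mulr_sumr; apply: eq_bigr => i _.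
rewrite raddf_sum mulr_sumr; apply: eq_bigr => j _.
by rewrite /= ReZ fd mulrCA mulrC.
Qed.

End FaithfulPowers.

(** * Scalar inequalities and limits *)

Section Scalar.
Variable R : realType.
Implicit Types (a x y p : R).

(** This is [ln (1 / x) <= 1 / x - 1], multiplied by [x]. *)
Lemma subr1_le_xlnx x : 0 < x -> x - 1 <= x * ln x.
Proof.
move=> x0; have /le_ln1Dx : -1 < x^-1 - 1 by rewrite ltrBrDr addNr invr_gt0.
rewrite addrCA subrr addr0 lnV ?posrE// => h.
have := ler_wpM2l (ltW x0) h; rewrite mulrBr mulfV ?gt_eqF//; lra.
Qed.

(** The graph of the concave function [y |-> 1 - exp (- y)] lies above its chord
    over [[0, a]]. The proof bounds the two increments of the function, on
    [[0, y]] and on [[y, a]], by the tangent at [y]. *)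
Lemma chord_le_1BexpRN a y : 0 <= y <= a ->
  y * (1 - expR (- a)) <= a * (1 - expR (- y)).
Proof.
move=> /andP[y0 ya]; have u0 := expR_gt0 (- y).
have := expR_ge1Dx y; have := expR_ge1Dx (y - a).
have ea : expR (- a) = expR (y - a) * expR (- y) by rewrite -expRD; f_equal; ring.
have ey : expR y * expR (- y) = 1 by rewrite expRxMexpNx_1.
rewrite ea; move: ey u0; move: (expR (- y)) (expR y) (expR (y - a)) => u v w.
move=> vu u0 hw hv.
have uv : u * (1 + y) <= 1 by rewrite -[leRHS]vu mulrC ler_pM2r.
have uw : u * (1 + (y - a)) <= w * u by rewrite mulrC ler_pM2r.
have h1 : 0 <= (a - y) * (1 - u * (1 + y)) by apply: mulr_ge0; lra.
have h2 : 0 <= y * (w * u - u * (1 + (y - a))) by apply: mulr_ge0; lra.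
by nra.
Qed.

Lemma cvg_bigsum (T I : Type) (F : set_system T) (FF : Filter F) (s : seq I)
    (f : I -> T -> R) (l : I -> R) :
  (forall i, f i x @[x --> F] --> l i) ->
  \sum_(i <- s) f i x @[x --> F] --> \sum_(i <- s) l i.
Proof. by move=> h; apply: cvg_big => //; apply: add_continuous. Qed.

(** The limit [a = 0] is included: it occurs when [rho] is not faithful. *)
Lemma cvg_powR (T : Type) (F : set_system T) (FF : Filter F) (f : T -> R) a p :
  0 < p -> (\forall x \near F, 0 <= f x) -> f x @[x --> F] --> a ->
  0 <= a -> f x `^ p @[x --> F] --> a `^ p.
Proof.
move=> p0 f0 fa; rewrite le_eqVlt => /predU1P[a0|a0].
  rewrite -{}a0 in fa *; rewrite powR0 ?gt_eqF//; apply/cvgr0Pnorm_lt => e e0.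
  have e0' : 0 < e `^ p^-1 by rewrite powR_gt0.
  near=> x; have fx0 : 0 <= f x by near: x.
  rewrite ger0_norm ?powR_ge0//.
  have -> : e = (e `^ p^-1) `^ p by rewrite -powRrM mulVf ?gt_eqF// powRr1// ltW.
  rewrite gt0_ltr_powR ?nnegrE ?powR_ge0//.
  have : `|f x| < e `^ p^-1 by near: x; exact: cvgr0_norm_lt.
  by rewrite ger0_norm.
have cont : {for a, continuous (fun x => x `^ p)}.
  apply/differentiable_continuous/derivable1_diffP.
  by apply: derivable_powR; rewrite in_itv/= a0.
exact: cvg_comp fa cont.
Unshelve. all: by end_near. Qed.

End Scalar.

(** * Densities in spectral form *)

Lemma tr_affine_mul (C : comPzSemiRingType) n (k t : C) (A S : 'M[C]_n) :
  \tr ((k *: (A + t *: 1%:M)) *m S) = k * (\tr (A *m S) + t * \tr S).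
Proof. by rewrite -scalemxAl mulmxDl -scalemxAl mul1mx mxtraceZ mxtraceD mxtraceZ. Qed.

Section Renyi.
Variables (R : realType) (n : nat) (sigma : opmx R n) (p : R).
Hypotheses (hsigma : faithful_density sigma) (p1 : 1 < p).
Implicit Types (rho V : opmx R n) (d : 'rV[R]_n).

Let p0 : 0 < p. Proof. exact: lt_trans p1. Qed.

(** The eigenbasis used is that of [A = Gamma_sigma^(1/p - 1) rho], not that of
    [rho]. *)
Lemma density_spectral rho : density rho ->
  exists V d, [/\ V \is unitarymx, forall i, 0 <= d 0 i
    & rho = Gamma sigma (1 - p^-1) (udiag V d)].
Proof.
move=> [hrho _].
have [V [d [hV d0 hA]]] := psdmx_udiag (Gamma_psd hsigma (p^-1 - 1) hrho).
exists V, d; split => //.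
rewrite -hA (GammaD hsigma) addrA subrK subrr; exact/esym/(Gamma0 hsigma).
Qed.

Lemma GammaN1 rho : Gamma sigma (-1) (Gamma sigma (1 - p^-1) rho) =
  Gamma sigma (- p^-1) rho.
Proof. by rewrite (GammaD hsigma) addrA addNr add0r. Qed.

(** Nonnegativity of the sandwiched Renyi entropy. By Young's inequality for
    [1 = tr rho = tr (A sigma^(1/q))] with [q = (1 - 1/p)^-1], one has
    [1 <= x / p + tr sigma / q = x / p + 1 - 1 / p]. *)
Lemma density_power_sum_ge1 V d : V \is unitarymx -> (forall i, 0 <= d 0 i) ->
  density (Gamma sigma (1 - p^-1) (udiag V d)) -> 1 <= \sum_i d 0 i `^ p.
Proof.
move=> hV d0 [_]; rewrite (tr_Gamma hsigma).
have [U [s [hU s0 s1 ->]]] := faithful_udiag hsigma.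
have q0 : 0 < 1 - p^-1 by rewrite subr_gt0 invf_lt1.
rewrite (mxpow_udiag _ _ hU); set e := map_mx _ s => htr.
have e0 i : 0 <= e 0 i by rewrite mxE powR_ge0.
have := trace_young hV hU d0 e0 p0 (q := (1 - p^-1)^-1).
rewrite htr invr_gt0 invrK => /(_ q0); rewrite addrC subrK => /(_ erefl) /=.
have -> : \sum_j e 0 j `^ (1 - p^-1)^-1 = 1.
  rewrite -[RHS]s1; apply: eq_bigr => j _.
  by rewrite mxE -powRrM mulfV ?gt_eqF// powRr1// ltW.
rewrite mul1r => h.
have : p^-1 <= (\sum_i d 0 i `^ p) / p by lra.
by rewrite -[leLHS]mul1r ler_pM2r// invr_gt0.
Qed.

(** The eigenvalues [(d i + t) / (1 + t c)] are those of [A + t 1] divided by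
    the trace of [Gamma_sigma^(1 - 1/p) (A + t 1)], where [c] is the trace of
    [Gamma_sigma^(1 - 1/p) 1 = sigma^(1 - 1/p)]. *)
Lemma udiag_density_mix V d : V \is unitarymx ->
  (forall i, 0 <= d 0 i) -> density (Gamma sigma (1 - p^-1) (udiag V d)) ->
  exists2 c : R, 0 <= c & forall t : R, 0 < t ->
    faithful_density (Gamma sigma (1 - p^-1)
      (udiag V (\row_i ((1 + t * c)^-1 * (d 0 i + t))))).
Proof.
move=> hV d0 [_ htr].
have [c c0 cE] : exists2 c : R, 0 <= c & \tr (mxpow sigma (1 - p^-1)) = c%:C.
  have [U [s [hU s0 _ ->]]] := faithful_udiag hsigma.
  rewrite (mxpow_udiag _ _ hU) (tr_udiag _ hU); eexists; last by [].
  by apply: sumr_ge0 => i _; rewrite mxE powR_ge0.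
exists c; [exact: c0 | move=> t t0].
have k0 : 0 < 1 + t * c by rewrite ltr_pwDl// mulr_ge0// ltW.
have m0 i : 0 < (1 + t * c)^-1 * (d 0 i + t).
  by rewrite mulr_gt0 ?invr_gt0// ltr_wpDl.
split; first split.
- by apply: (Gamma_psd hsigma); apply: udiag_psd => i; rewrite mxE ltW.
- rewrite (udiag_affine _ _ _ hV) (tr_Gamma hsigma) tr_affine_mul.
  rewrite -(tr_Gamma hsigma) htr cE.
  by rewrite -(rmorphM _ t) -(rmorph1 (real_complex R)) -rmorphD -rmorphM mulVf ?gt_eqF.
- apply: mxrank_unit; apply: (Gamma_unit hsigma); rewrite (udiag_unit _ hV).
  by apply/forallP => i; rewrite mxE gt_eqF.
Qed.

(** The Beckner inequality extends from faithful states to all densities, by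
    letting [t] tend to [0] along the states of [udiag_density_mix]. *)
Lemma beckner_density (L : {linear opmx R n -> opmx R n}) (alpha : R) V d :
  beckner_inequality p sigma L alpha -> V \is unitarymx ->
  (forall i, 0 <= d 0 i) -> density (Gamma sigma (1 - p^-1) (udiag V d)) ->
  alpha * ((\sum_i d 0 i `^ p - 1) / (p * (p - 1))) <=
  p ^- 2 * energy p sigma L (Gamma sigma (- p^-1) (udiag V d)).
Proof.
move=> hbeck hV d0 hrho.
have [c c0 hmix] := udiag_density_mix hV d0 hrho.
have [K hK] := energy_quadratic hsigma p L hV.
pose m i (t : R) := (1 + t * c)^-1 * (d 0 i + t).
have m0 i t : 0 < t -> 0 <= m i t.
  by move=> t0; rewrite mulr_ge0 ?invr_ge0 ?addr_ge0 ?mulr_ge0 ?(ltW t0).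
have m_near i : \forall t \near 0^'+, 0 <= m i t.
  by near=> t; apply: m0.
have m_cvg i : m i t @[t --> 0^'+] --> d 0 i.
  have -> : d 0 i = (1 + 0 * c)^-1 * (d 0 i + 0).
    by rewrite mul0r !addr0 invr1 mul1r.
  have id0 : (t : R) @[t --> 0^'+] --> (0 : R) by apply: cvg_at_right_filter; apply: cvg_id.
  apply: cvgM; last by apply: cvgD id0; apply: cvg_cst.
  apply: cvgV; first by rewrite mul0r addr0 oner_neq0.
  by apply: cvgD; [exact: cvg_cst | apply: cvgM id0 _; exact: cvg_cst].
have powm_cvg r i : 0 < r -> m i t `^ r @[t --> 0^'+] --> d 0 i `^ r.
  by move=> r0; apply: cvg_powR.
rewrite (hK _ d0).
have lhs_cvg : alpha * ((\sum_i m i t `^ p - 1) / (p * (p - 1))) @[t --> 0^'+] -->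
    alpha * ((\sum_i d 0 i `^ p - 1) / (p * (p - 1))).
  apply: cvgM; first exact: cvg_cst.
  apply: cvgM; last exact: cvg_cst.
  apply: cvgB; last exact: cvg_cst.
  by apply: cvg_bigsum => i; apply: powm_cvg.
have rhs_cvg :
    p ^- 2 * (\sum_i \sum_j K i j * (m i t `^ (p - 1) * m j t)) @[t --> 0^'+] -->
    p ^- 2 * (\sum_i \sum_j K i j * (d 0 i `^ (p - 1) * d 0 j)).
  apply: cvgM; first exact: cvg_cst.
  apply: cvg_bigsum => i; apply: cvg_bigsum => j.
  apply: cvgM; first exact: cvg_cst.
  by apply: cvgM => //; apply: powm_cvg; rewrite subr_gt0.
apply: ler_cvg_to lhs_cvg rhs_cvg _.
near=> t; have t0 : 0 < t by [].
have dE i : (\row_i (m i t)) 0 i = m i t by rewrite mxE.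
have dm0 i : 0 <= (\row_i (m i t)) 0 i by rewrite dE m0.
have := hbeck _ (hmix t t0); rewrite -[X in udiag _ X]/(\row_i m i t).
rewrite /pdivergence GammaN1 (pnorm_powR hsigma hV dm0 p0) (hK _ dm0).
under eq_bigr do rewrite dE.
by under [X in _ <= _ * X]eq_bigr do under eq_bigr do rewrite !dE.
Unshelve. all: by end_near. Qed.

Lemma sandwiched_renyi_spectral V d :
  V \is unitarymx -> (forall i, 0 <= d 0 i) ->
  sandwiched_renyi p (Gamma sigma (1 - p^-1) (udiag V d)) sigma =
    ln (\sum_i d 0 i `^ p) / (p - 1).
Proof.
move=> hV d0; rewrite /sandwiched_renyi GammaN1.
by rewrite -(pnorm_powR hsigma hV d0 p0) ln_powR /hconj mulrAC.
Qed.

Lemma renyi_production_spectral (L : opmx R n -> opmx R n) V d :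
  V \is unitarymx -> (forall i, 0 <= d 0 i) ->
  renyi_production p sigma L (Gamma sigma (1 - p^-1) (udiag V d)) =
    4 * energy p sigma L (Gamma sigma (- p^-1) (udiag V d)) /
    (p * \sum_i d 0 i `^ p).
Proof.
move=> hV d0; rewrite /renyi_production GammaN1.
by rewrite (pnorm_powR hsigma hV d0 p0).
Qed.

End Renyi.

Theorem proposition3p15 (R : realType) (n : nat)
    (P : R -> {linear opmx R n -> opmx R n})
    (L : {linear opmx R n -> opmx R n}) (sigma : opmx R n) (p : R)
    (hP : quantum_markov_semigroup P) (hL : generator P L)
    (hprim : primitive_with P sigma) (hkms : kms_detailed_balance sigma L)
    (hp : 1 < p) :
  (forall alphahat : R, 0 < alphahat -> renyi_inequality p sigma L alphahat ->
     exists alpha : R,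
       alphahat / 2 <= alpha /\ beckner_inequality p sigma L alpha)
  /\
  (forall alpha : R, 0 < alpha -> beckner_inequality p sigma L alpha ->
     forall a : R, 0 < a ->
     let c_a := (1 - expR (- a)) / a in
     forall rho : opmx R n, density rho ->
       (sandwiched_renyi p rho sigma <= a / (p - 1) ->
          4 * c_a * alpha * sandwiched_renyi p rho sigma
            <= renyi_production p sigma L rho)
       /\
       (a / (p - 1) <= sandwiched_renyi p rho sigma ->
          4 * alpha / (p - 1) * (1 - expR (- a))
            <= renyi_production p sigma L rho)).
Proof.
have hsigma : faithful_density sigma by case: hprim => [[]].
have p0 : 0 < p by exact: lt_trans hp.
have pm0 : 0 < p - 1 by rewrite subr_gt0.
split.
  move=> ah ah0 hren; exists (ah / 2); split => // rho [hrho _].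
  have [V [d [hV d0 rE]]] := density_spectral p hsigma hrho.
  rewrite rE in hrho *; have x1 := density_power_sum_ge1 hsigma hp hV d0 hrho.
  have := hren _ hrho; rewrite (sandwiched_renyi_spectral hsigma hp hV d0)
    (renyi_production_spectral hsigma hp L hV d0).
  rewrite /pdivergence (GammaN1 _ hsigma) (pnorm_powR hsigma hV d0 p0).
  move: (energy _ _ _ _) x1 => E; move: (\sum_i _) => x x1 h.
  have x0 : 0 < x by lra.
  have hx := subr1_le_xlnx x0.
  have {}h : ah * p * (x * ln x) <= 2 * (p - 1) * E.
    have m0 : 0 <= p * x * (p - 1) / 2 by rewrite !mulr_ge0 ?ltW.
    have -> : ah * p * (x * ln x) =
        p * x * (p - 1) / 2 * (2 * ah * (ln x / (p - 1))) by field; lra.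
    have -> : 2 * (p - 1) * E = p * x * (p - 1) / 2 * (4 * E / (p * x)).
      by field; lra.
    exact: ler_wpM2l.
  have m0 : 0 < 2 * p ^+ 2 * (p - 1) by rewrite !mulr_gt0 ?exprn_gt0.
  have -> : ah / 2 * ((x - 1) / (p * (p - 1))) =
      ah * p * (x - 1) / (2 * p ^+ 2 * (p - 1)) by field; lra.
  have -> : p ^- 2 * E = 2 * (p - 1) * E / (2 * p ^+ 2 * (p - 1)).
    by field; lra.
  rewrite ler_pM2r ?invr_gt0//; apply: le_trans h; apply: ler_wpM2l hx.
  by rewrite mulr_ge0 ?ltW.
move=> alpha alpha0 hbeck a a0 /= rho hrho.
have [V [d [hV d0 rE]]] := density_spectral p hsigma hrho.
rewrite rE in hrho *; have x1 := density_power_sum_ge1 hsigma hp hV d0 hrho.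
have := beckner_density hsigma hp hbeck hV d0 hrho.
rewrite (sandwiched_renyi_spectral hsigma hp hV d0)
  (renyi_production_spectral hsigma hp L hV d0).
move: (energy _ _ _ _) x1 => E; move: (\sum_i _) => x x1 h.
have x0 : 0 < x by lra.
(* [1 / x] is [exp (- (p - 1) D)], here with [(p - 1) D = ln x]. *)
have prodE : 4 * alpha / (p - 1) * (1 - expR (- ln x)) <= 4 * E / (p * x).
  rewrite expRN lnK ?posrE//.
  have -> : 4 * alpha / (p - 1) * (1 - x^-1) =
      4 * p / x * (alpha * ((x - 1) / (p * (p - 1)))) by field; lra.
  have -> : 4 * E / (p * x) = 4 * p / x * (p ^- 2 * E) by field; lra.
  by apply: ler_wpM2l h; rewrite divr_ge0 ?mulr_ge0 ?ltW.
have y0 := ln_ge0 x1.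
split => hD.
  have ya : ln x <= a by move: hD; rewrite ler_pM2r// invr_gt0.
  apply: le_trans prodE; have := @chord_le_1BexpRN _ a (ln x).
  rewrite y0 ya => /(_ isT) hc.
  have -> : 4 * ((1 - expR (- a)) / a) * alpha * (ln x / (p - 1)) =
      4 * alpha / ((p - 1) * a) * (ln x * (1 - expR (- a))) by field; lra.
  have -> : 4 * alpha / (p - 1) * (1 - expR (- ln x)) =
      4 * alpha / ((p - 1) * a) * (a * (1 - expR (- ln x))) by field; lra.
  by apply: ler_wpM2l hc; rewrite divr_ge0 ?mulr_ge0 ?ltW.
have ya : a <= ln x by move: hD; rewrite ler_pM2r// invr_gt0.
apply: le_trans prodE; apply: ler_wpM2l.
  by rewrite divr_ge0 ?mulr_ge0 ?ltW.
by rewrite lerD2l lerN2 ler_expR lerN2.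
Qed.
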